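(* Let $q\in\mathbb{C}$ with $0<|q|<1$, let $x=\frac12(z+z^{-1})$ with $z\in\mathbb{C}\setminus\{0\}$, let $a,b,t,\delta\in\mathbb{C}$ with $|t|<1$, and let $\gamma\in\mathbb{C}$ with $0<|\gamma|<1$. Then $$\sum_{n=0}^\infty \frac{q^{\binom n2}\,t^n\,(\gamma;q)_n}{(q;q)_n(\delta;q)_n}\,Q_n(x;a,b|q^{-1})=\frac{(\gamma,-tz,-tz^{-1};q)_\infty}{(\delta,-at,-bt;q)_\infty}\;{}_3\phi_2\!\left(\begin{array}{c}\frac{\delta}{\gamma},-at,-bt\\ -tz,-tz^{-1}\end{array};q,\gamma\right).$$
   Context: Notation: $(A;p)_n=\prod_{j=0}^{n-1}(1-Ap^j)$ for $p\in\mathbb{C}\setminus\{0\}$, $n\ge 0$; $(A;q)_\infty=\prod_{j\ge0}(1-Aq^j)$ for $|q|<1$; $(A_1,\dots,A_k;q)_n=\prod_i(A_i;q)_n$ (also for $n=\infty$). $\Omega_q=\{q^{-k}:k=0,1,2,\dots\}$, $\binom n2=\frac{n(n-1)}2$. Basic hypergeometric series: ${}_3\phi_2(a_1,a_2,a_3;b_1,b_2;q,w)=\sum_{k\ge0}\frac{(a_1,a_2,a_3;q)_k}{(q,b_1,b_2;q)_k}w^k$, convergent for $|w|<1$. Standing convention: denominator parameters do not lie in $\Omega_q$ (here $\delta,-tz,-tz^{-1}\notin\Omega_q$). Al-Salam--Chihara polynomials: for a base $p\in\mathbb{C}\setminus\{0\}$ with $|p|\neq1$, $x=\frac12(z+z^{-1})$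 and $a\neq0$, $$Q_n(x;a,b|p)=a^{-n}\sum_{k=0}^n\frac{(p^{-n},az,az^{-1};p)_k\,(abp^k;p)_{n-k}}{(p;p)_k}\,p^k,$$ which equals $a^{-n}(ab;p)_n\,{}_3\phi_2(p^{-n},az,az^{-1};ab,0;p,p)$ when the latter is defined; it is a polynomial in $a,b$ (symmetric), and is defined for $a=0$ by continuity. The $q^{-1}$-Al-Salam--Chihara polynomials $Q_n(x;a,b|q^{-1})$ are obtained by taking $p=q^{-1}$.
   Formalization: For |t|<1 alone the left series can diverge (e.g. q=t=γ=1/2, z=i, a=4, b=δ=0), so convergence is claimed for |at|,|bt|<1 and the identity whenever the series converges; -at and -bt are also assumed not in Ω_q, since otherwise the right side divides by zero. *)

(* Defs.v *)
From HB Require Import structures.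
From mathcomp Require Import all_boot all_order all_algebra.
From mathcomp Require Import complex ring.
From mathcomp Require Import all_classical all_reals all_analysis.
Import Order.TTheory GRing.Theory Num.Theory.
Import numFieldNormedType.Exports.

Set Implicit Arguments.
Unset Strict Implicit.
Unset Printing Implicit Defensive.

Local Open Scope classical_set_scope.
Local Open Scope ring_scope.

Section QSeries.
Context {K : numFieldType}.
Implicit Types (A a b p q w z : K) (n k : nat).

(* Stated over an abstract K because the topology of a numFieldType is not
   inferred on the concrete type R[i]. *)
Definition csummable (u : nat -> K) : Prop := cvgn (series u).
Definition csum (u : nat -> K) : K := limn (series u).

(* (A; p)_n *)
Definition qpoch A p n : K := \prod_(j < n) (1 - A * p ^+ j).

(* (A; q)_oo, meaningful for |q| < 1 *)
Definition qpochoo A q : K := limn (qpoch A q).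

(* {q^{-k} : k = 0, 1, 2, ...} *)
Definition Omega q : set K := [set A | exists k : nat, A = q ^- k].

Definition phi32_term (a1 a2 a3 b1 b2 q w : K) (k : nat) : K :=
  (qpoch a1 q k * qpoch a2 q k * qpoch a3 q k)
  / (qpoch q q k * qpoch b1 q k * qpoch b2 q k) * w ^+ k.

(* meaningful for |w| < 1 and b1, b2 outside Omega q *)
Definition phi32 (a1 a2 a3 b1 b2 q w : K) : K :=
  csum (phi32_term a1 a2 a3 b1 b2 q w).

(* The explicit formula for Q_n(x; a, b | p) at x = (z + z^-1) / 2, a != 0 *)
Definition ASC_nz n z a b p : K :=
  a ^- n * \sum_(k < n.+1)
    (qpoch (p ^- n) p k * qpoch (a * z) p k * qpoch (a * z^-1) p k
     * qpoch (a * b * p ^+ k) p (n - k)) / qpoch p p k * p ^+ k.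

(* extended to a = 0 by continuity in a *)
Definition ASC_z n z a b p : K :=
  if a == 0 then lim (ASC_nz n z c b p @[c --> (0 : K)^'])
  else ASC_nz n z a b p.

Lemma ASC_z_inv n z a b p : ASC_z n z^-1 a b p = ASC_z n z a b p.
Proof.
suff E c : ASC_nz n z^-1 c b p = ASC_nz n z c b p.
  by rewrite /ASC_z E; under [in LHS]eq_fun do rewrite E.
rewrite /ASC_nz invrK; congr (_ * _); apply: eq_bigr => k _.
by rewrite (mulrAC _ (qpoch (c * z^-1) p k)).
Qed.

End QSeries.

(* The Al-Salam--Chihara polynomial Q_n(x; a, b | p).  The formula above needs
   a z such that x = (z + z^-1) / 2; the two roots of this equation are inverse
   of each other and give the same value, see ASCE. *)
Definition ASC {C : numClosedFieldType} (n : nat) (x a b p : C) : C :=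
  ASC_z n (x + sqrtC (x ^+ 2 - 1)) a b p.

Lemma ASCE {C : numClosedFieldType} (n : nat) (x z a b p : C) :
  z != 0 -> x = (z + z^-1) / 2 -> ASC n x a b p = ASC_z n z a b p.
Proof.
move=> z0 ->; rewrite /ASC; set s := sqrtC _.
have n2 : (2 : C) != 0 by rewrite pnatr_eq0.
have : s ^+ 2 = ((z - z^-1) / 2) ^+ 2 by rewrite /s sqrtCK; field; rewrite z0.
move/eqP; rewrite eqf_sqr => /orP[|] /eqP ->.
  by congr ASC_z; field; rewrite z0.
by rewrite -[RHS]ASC_z_inv; congr ASC_z; field; rewrite z0.
Qed.

(* Main.v *)
Require Import Defs.
From HB Require Import structures.
From mathcomp Require Import all_boot all_order all_algebra.
From mathcomp Require Import complex ring.
From mathcomp Require Import all_classical all_reals all_analysis.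
Import Order.TTheory GRing.Theory Num.Theory.
Import numFieldNormedType.Exports.

(** Write [c n] for [q ^+ 'C(n, 2) / (q; q)_n * Q_n(x; a, b | q^-1)].  In base
    1/q the three-term recurrence of the Al-Salam--Chihara polynomials says that
    [f s = sum_n c n * s ^+ n] satisfies
    [(1 + a s) (1 + b s) f s = (1 + s z) (1 + s / z) f (q s)]
    ([ASC_genf_coefP]).  Iterating this towards [f 0 = 1] evaluates [f t] as
    [(- t z, - t / z; q)_oo / (- a t, - b t; q)_oo], and [f (t q^k)] as [f t]
    times a quotient of finite shifted factorials ([qdiff_csum_qpochoo],
    [qdiff_csum_qpoch]).

    The remaining factor [(gamma; q)_n / (delta; q)_n] is expanded by the
    q-binomial theorem, itself an instance of the same evaluation: it is
    [g (q^n) / g 1], where [g] has coefficients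
    [e k = (delta / gamma; q)_k / (q; q)_k * gamma ^+ k] and
    [g 1 = (delta; q)_oo / (gamma; q)_oo].  Interchanging the two summations
    turns [sum_n c n * t ^+ n * g (q^n)] into [sum_k e k * f (t q^k)]
    ([swap_cvg]), and substituting the value of [f (t q^k)] gives the 3-phi-2
    series with its prefactor.

    Two points of convergence need care.  When [|a t|] and [|b t|] are less than
    1, the recurrence forces [c n * t ^+ n] to be absolutely summable
    ([qdiff_abs_summable]).  When the left-hand series is only assumed to
    converge, its terms tend to 0, so [c n * t ^+ n] is merely known to be
    bounded; the interchange is still legitimate because all terms with [k > 0]
    carry a factor [q ^+ (n * k)], and the terms with [k = 0] form the series
    [f t] itself, whose convergence is thus equivalent to that of the given
    series ([csummable_swap]). *)
Set Implicit Arguments.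
Unset Strict Implicit.
Unset Printing Implicit Defensive.
Local Open Scope ring_scope.

(** * Absolutely summable sequences *)

Definition abs_summable (K : numFieldType) (u : nat -> K) : Prop :=
  exists M, forall n, \sum_(0 <= i < n) `|u i| <= M.

(** The form of completeness on which the q-series arguments rest: they are valid
    over any [numFieldType] with this property, and only [complex_abs_complete]
    looks at real and imaginary parts. *)
Definition abs_complete (K : numFieldType) : Prop :=
  forall u : nat -> K, abs_summable u -> csummable u.

Section AbsoluteSummation.
Local Open Scope classical_set_scope.
Context {K : numFieldType}.
Implicit Types (u v : nat -> K) (l M r x : K).

Lemma abs_summable_ge0 u M :
  (forall n, \sum_(0 <= i < n) `|u i| <= M) -> 0 <= M.
Proof. by move=> /(_ 0%N); rewrite big_geq. Qed.

Lemma abs_summable_le u v :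
  (forall n, `|u n| <= `|v n|) -> abs_summable v -> abs_summable u.
Proof.
move=> uv [M vM]; exists M => n; apply: le_trans (vM n).
exact: ler_sum.
Qed.

Lemma abs_summable_bounded u :
  abs_summable u -> exists M, forall n, `|u n| <= M.
Proof.
move=> [M uM]; exists M => n; apply: le_trans (uM n.+1).
by rewrite big_nat_recr//= lerDr sumr_ge0.
Qed.

Lemma abs_summableZ c u : abs_summable u -> abs_summable (fun n => c * u n).
Proof.
move=> [M uM]; exists (`|c| * M) => n.
under eq_bigr do rewrite normrM.
by rewrite -mulr_sumr ler_wpM2l.
Qed.

Lemma abs_summableD u v :
  abs_summable u -> abs_summable v -> abs_summable (fun n => u n + v n).
Proof.
move=> [M uM] [N vN]; exists (M + N) => n.
apply: le_trans (lerD (uM n) (vN n)); rewrite -big_split /=.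
by apply: ler_sum => i _; exact: ler_normD.
Qed.

Lemma abs_summableMbounded u v M :
  (forall n, `|v n| <= M) -> abs_summable u -> abs_summable (fun n => v n * u n).
Proof.
move=> vM /(abs_summableZ M); apply: abs_summable_le => n.
rewrite !normrM ler_wpM2r// (le_trans (vM n))// real_ler_norm//.
by rewrite ger0_real// (le_trans _ (vM n)).
Qed.

Lemma abs_summable_shift u : abs_summable u -> abs_summable (fun n => u n.+1).
Proof.
move=> [M uM]; exists M => n; apply: le_trans (uM n.+1).
by rewrite big_nat_recl// lerDr.
Qed.

Lemma geometric_sum_le x n :
  `|x| < 1 -> \sum_(0 <= i < n) `|x| ^+ i <= (1 - `|x|)^-1.
Proof.
move=> x1; have x0 : 0 < 1 - `|x| by rewrite subr_gt0.
rewrite -[leRHS]mul1r ler_pdivlMr// mulrC big_mkord.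
have -> : (1 - `|x|) * (\sum_(i < n) `|x| ^+ i) = 1 - `|x| ^+ n.
  by rewrite -[RHS]opprB subrX1 -mulNr opprB.
by rewrite gerBl exprn_ge0.
Qed.

Lemma abs_summable_geometric x : `|x| < 1 -> abs_summable (fun n => x ^+ n).
Proof.
move=> x1; exists (1 - `|x|)^-1 => n.
by under eq_bigr do rewrite normrX; exact: geometric_sum_le.
Qed.

(** If S is the n-th partial sum of the |u i|, the recurrence gives
    S <= |u 0| + |r| S + M, and |r| < 1 allows S to be isolated. *)
Lemma abs_summable_rec u v r : `|r| < 1 -> abs_summable v ->
  (forall n, u n.+1 = r * u n + v n) -> abs_summable u.
Proof.
move=> r1 [M vM] uS; have r0 : 0 < 1 - `|r| by rewrite subr_gt0.
exists ((`|u 0%N| + M) / (1 - `|r|)) => n.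
rewrite ler_pdivlMr// mulrBr mulr1 lerBlDr.
apply: (@le_trans _ _ (\sum_(0 <= i < n.+1) `|u i|)).
  by rewrite [leRHS]big_nat_recr//= lerDl.
rewrite big_nat_recl// -addrA lerD2l addrC mulrC mulr_sumr.
apply: le_trans (lerD (lexx _) (vM n)); rewrite -big_split.
by apply: ler_sum => i _; rewrite uS -normrM ler_normD.
Qed.

Lemma norm_cvgn_le u l a M :
  u @ \oo --> l -> (\forall n \near \oo, `|u n - a| <= M) -> `|l - a| <= M.
Proof.
move=> /cvgrPdist_lt ul uM; apply/ler_addgt0Pl => e e0.
near \oo => n.
have -> : l - a = (l - u n) + (u n - a) by rewrite addrA subrK.
rewrite (le_trans (ler_normD _ _))// lerD//.
- by apply/ltW; near: n; exact: ul.
- by near: n.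
Unshelve. all: by end_near. Qed.

Lemma ge_cvgn_norm u l M :
  u @ \oo --> l -> (\forall n \near \oo, M <= `|u n|) -> M <= `|l|.
Proof.
move=> /cvgrPdist_lt ul uM; apply/ler_addgt0Pl => e e0.
near \oo => n.
have := lerB_dist (u n) (u n - l); rewrite subKr lerBlDr addrC => lun.
apply: (@le_trans _ _ `|u n|); first by near: n.
rewrite (le_trans lun)// lerD2r distrC ltW//.
by near: n; exact: ul.
Unshelve. all: by end_near. Qed.

Lemma cvgn_unique u l l' : u @ \oo --> l -> u @ \oo --> l' -> l = l'.
Proof. by move=> ul ul'; exact: (cvg_unique _ ul ul'). Qed.

Lemma cvgnS u l : u @ \oo --> l -> (fun n => u n.+1) @ \oo --> l.
Proof. by move=> ul; rewrite (cvg_shiftS u). Qed.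

Lemma bounded_of_tail u N M :
  (forall n, (N <= n)%N -> `|u n| <= M) -> exists M', forall n, `|u n| <= M'.
Proof.
move=> uM; have M0 : 0 <= M by rewrite (le_trans _ (uM N _)).
have s0 : 0 <= \sum_(0 <= i < N) `|u i| by exact: sumr_ge0.
exists (\sum_(0 <= i < N) `|u i| + M) => n; case: (ltnP n N) => nN.
  by rewrite big_mkord (bigD1 (Ordinal nN))//= -addrA lerDl addr_ge0 ?sumr_ge0.
by rewrite (le_trans (uM n nN))// lerDr.
Qed.

Lemma cvgn_bounded u l : u @ \oo --> l -> exists M, forall n, `|u n| <= M.
Proof.
move=> /cvgrPdist_lt /(_ 1 ltr01)[N _ uN].
apply: (@bounded_of_tail _ N (1 + `|l|)) => n Nn.
have -> : u n = l - (l - u n) by rewrite subKr.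
by rewrite (le_trans (ler_normB _ _))// addrC lerD2r ltW//; exact: uN.
Qed.

Lemma squeeze0 u v l : (forall n, `|u n - l| <= `|v n|) -> v @ \oo --> 0 ->
  u @ \oo --> l.
Proof.
move=> uv /cvgrPdist_lt v0; apply/cvgrPdist_lt => e e0.
near=> n; rewrite distrC (le_lt_trans (uv n))//.
by near: n; apply: filterS (v0 _ e0) => n; rewrite sub0r normrN.
Unshelve. all: by end_near. Qed.

Lemma csum_le u l M : series u @ \oo --> l ->
  (forall n, \sum_(0 <= i < n) `|u i| <= M) -> `|l| <= M.
Proof.
move=> ul uM; rewrite -[l]subr0; apply: (norm_cvgn_le ul).
by near=> n; rewrite subr0 (le_trans (ler_norm_sum _ _ _)).
Unshelve. all: by end_near. Qed.

Lemma csumZ c u l :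
  series u @ \oo --> l -> series (fun n => c * u n) @ \oo --> c * l.
Proof.
move=> ul; have -> : series (fun n => c * u n) = fun n => c * series u n.
  by apply/funext => n; rewrite /series/= mulr_sumr.
by apply: cvgM => //; exact: cvg_cst.
Qed.

Lemma csum_shift u l :
  series u @ \oo --> l -> series (fun n => u n.+1) @ \oo --> l - u 0%N.
Proof.
move=> ul; have -> : series (fun n => u n.+1) = fun n => series u n.+1 - u 0%N.
  by apply/funext => n; rewrite /series/= big_nat_recl//= addrC addKr.
by apply: cvgB; [exact: cvgnS|exact: cvg_cst].
Qed.

Lemma csum_sum (I : Type) (s : seq I) (c : I -> K) (u : I -> nat -> K) (l : I -> K) :
  (forall i, series (u i) @ \oo --> l i) ->
  series (fun n => \sum_(i <- s) c i * u i n) @ \oo --> \sum_(i <- s) c i * l i.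
Proof.
move=> ul.
have -> : series (fun n => \sum_(i <- s) c i * u i n)
    = fun n => \sum_(i <- s) c i * series (u i) n.
  apply/funext => n; rewrite /series/= exchange_big/=.
  by apply: eq_bigr => i _; rewrite mulr_sumr.
elim: s => [|i s IH].
  rewrite big_nil; under eq_fun do rewrite big_nil; exact: cvg_cst.
rewrite big_cons; under eq_fun do rewrite big_cons.
by apply: cvgD => //; apply: cvgM => //; exact: cvg_cst.
Qed.

Context (hK : abs_complete K).

Lemma abs_summable_cvg u : abs_summable u -> series u @ \oo --> csum u.
Proof. by move/hK. Qed.

Lemma cvgn_expr x : `|x| < 1 -> (fun n => x ^+ n) @ \oo --> (0 : K).
Proof.
move=> x1; have := hK (abs_summable_geometric x1).
exact: cvg_series_cvg_0.
Qed.

End AbsoluteSummation.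

(** * Finite and infinite shifted factorials *)

Section Pochhammer.
Local Open Scope classical_set_scope.
Context {K : numFieldType}.
Implicit Types (A p q : K) (n N : nat).

Lemma qpoch0 A p : qpoch A p 0 = 1.
Proof. by rewrite /qpoch big_ord0. Qed.

Lemma qpochS A p n : qpoch A p n.+1 = qpoch A p n * (1 - A * p ^+ n).
Proof. by rewrite /qpoch big_ord_recr. Qed.

Lemma qpochD A p N n : qpoch A p (N + n) = qpoch A p N * qpoch (A * p ^+ N) p n.
Proof.
elim: n => [|n IH]; first by rewrite addn0 qpoch0 mulr1.
by rewrite addnS !qpochS IH exprD !mulrA.
Qed.

Lemma qpochSl A p n : qpoch A p n.+1 = (1 - A) * qpoch (A * p) p n.
Proof. by rewrite -add1n qpochD qpochS qpoch0 mul1r !mulr1. Qed.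

Lemma qpoch_base0 p n : qpoch 0 p n = 1.
Proof. by elim: n => [|n IH]; rewrite ?qpoch0// qpochS IH mul0r subr0 mulr1. Qed.

Lemma qpoch_factor_neq0 A q n : q != 0 -> ~ Omega q A -> 1 - A * q ^+ n != 0.
Proof.
move=> q0 AO; rewrite subr_eq0 eq_sym; apply/eqP => Aq1; apply: AO; exists n.
by rewrite -[A]mulr1 -(divff (expf_neq0 n q0)) mulrA Aq1 mul1r.
Qed.

Lemma qpoch_neq0 A q n : q != 0 -> ~ Omega q A -> qpoch A q n != 0.
Proof. by move=> q0 AO; apply/prodf_neq0 => i _; exact: qpoch_factor_neq0. Qed.

Lemma Omega_norm_lt1 A q : q != 0 -> `|q| < 1 -> `|A| < 1 -> ~ Omega q A.
Proof.
move=> q0 q1 A1 [k Ak]; move: A1; rewrite Ak normfV normrX invf_lt1 ?exprn_gt0 ?normr_gt0//.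
by move=> /lt_geF; rewrite exprn_ile1// ltW.
Qed.

(** With s the sum of the |A q^i| for i < n, the product is at least
    [1 - s] and at most [(1 - s)^-1] in norm, and s <= 1/2. *)
Lemma qpoch_small_bounds A q n : `|q| < 1 -> `|A| * (1 - `|q|)^-1 <= 2^-1 ->
  2^-1 <= `|qpoch A q n| <= 2.
Proof.
move=> q1 Aq; pose s k := `|A| * \sum_(0 <= i < k) `|q| ^+ i.
have sS k : s k.+1 = s k + `|A * q ^+ k|.
  by rewrite /s big_nat_recr//= mulrDr normrM normrX.
have s0 k : 0 <= s k by rewrite mulr_ge0// sumr_ge0// => i _; rewrite exprn_ge0.
have s12 k : s k <= 2^-1.
  by apply: le_trans Aq; rewrite ler_wpM2l// geometric_sum_le.
have s1 k : 2^-1 <= 1 - s k.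
  rewrite -subr_ge0 (_ : _ - _ = 2^-1 - s k) ?subr_ge0//.
  by field.
have s00 : s 0%N = 0 by rewrite /s big_geq// mulr0.
clearbody s; have [lo up] : 1 - s n <= `|qpoch A q n| /\ `|qpoch A q n| * (1 - s n) <= 1.
  elim: n => [|n [lo up]].
    by rewrite qpoch0 s00 subr0 normr1 mulr1.
  have s1n : 0 <= 1 - s n by rewrite (le_trans _ (s1 n)).
  have s1Sn : 0 <= 1 - s n.+1 by rewrite (le_trans _ (s1 n.+1)).
  rewrite qpochS normrM; set P : K := `|qpoch A q n|; move: s1Sn.
  have P0 : 0 <= P by exact: normr_ge0.
  rewrite sS; set x : K := `|A * q ^+ n| => s1Sn.
  have x0 : 0 <= x by exact: normr_ge0.
  split.
    apply: (@le_trans _ _ ((1 - s n) * (1 - x))).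
      rewrite -subr_ge0 (_ : _ - _ = s n * x) ?mulr_ge0//.
      by ring.
    apply: (@le_trans _ _ ((1 - s n) * `|1 - A * q ^+ n|)).
      by rewrite ler_wpM2l// (le_trans _ (lerB_dist _ _))// normr1.
    by rewrite ler_wpM2r.
  apply: le_trans up; rewrite -mulrA ler_wpM2l//.
  apply: (@le_trans _ _ ((1 + x) * (1 - (s n + x)))).
    by rewrite ler_wpM2r// (le_trans (ler_normB _ _))// normr1.
  rewrite -subr_ge0 (_ : _ - _ = x * (s n + x)) ?mulr_ge0 ?addr_ge0//.
  by ring.
apply/andP; split; first exact: le_trans (s1 n) lo.
rewrite -[leLHS]mulr1 -[X in _ * X](@mulVf _ 2) ?pnatr_eq0// mulrA ler_piMl//.
by apply: le_trans up; rewrite ler_wpM2l.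
Qed.

Context (hK : abs_complete K).

Section Convergence.
Context (q : K) (q0 : q != 0) (q1 : `|q| < 1).

Lemma qpoch_tail_small A : exists N, `|A * q ^+ N| * (1 - `|q|)^-1 <= 2^-1.
Proof.
have /cvgrPdist_lt : (fun n => A * (1 - `|q|)^-1 * q ^+ n) @ \oo --> (0 : K).
  rewrite -(mulr0 (A * (1 - `|q|)^-1)); apply: cvgM; first exact: cvg_cst.
  exact: cvgn_expr.
move=> /(_ 2^-1); rewrite invr_gt0 ltr0n => /(_ isT)[N _ /(_ N (leqnn N))].
rewrite /= sub0r normrN mulrAC normrM [X in _ * X]ger0_norm.
  by move=> /ltW; exists N.
by rewrite invr_ge0 subr_ge0 ltW.
Qed.

Lemma qpoch_bounded A : exists M, forall n, `|qpoch A q n| <= M.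
Proof.
have [N AN] := qpoch_tail_small A.
apply: (@bounded_of_tail _ _ N (`|qpoch A q N| * 2)) => n /subnKC <-.
rewrite qpochD normrM ler_wpM2l//.
by have /andP[] := qpoch_small_bounds (n - N) q1 AN.
Qed.

(** The increments of the bounded sequence [qpoch A q] are dominated by a
    geometric progression. *)
Lemma qpoch_cvg A : qpoch A q @ \oo --> qpochoo A q.
Proof.
suff : cvgn (qpoch A q) by [].
have [M PM] := qpoch_bounded A.
pose w n := qpoch A q n * (- A * q ^+ n).
have /(abs_summable_cvg hK) wcv : abs_summable w.
  apply: (abs_summableMbounded PM); apply: abs_summableZ.
  exact: abs_summable_geometric.
apply/cvg_ex; exists (csum w + 1).
have -> : qpoch A q = fun n => series w n + 1.
  apply/funext; elim => [|n IH]; first by rewrite /series/= big_geq// qpoch0 add0r.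
  by rewrite qpochS IH /series/= big_nat_recr//= /w IH /series/=; ring.
by apply: cvgD; [exact: wcv|exact: cvg_cst].
Qed.

(** Past the index N where the tail is small, the remaining product stays at
    least 1/2 in norm; the first N factors do not vanish. *)
Lemma qpochoo_neq0 A : ~ Omega q A -> qpochoo A q != 0.
Proof.
move=> AO; have [N AN] := qpoch_tail_small A.
have PN0 : 0 < `|qpoch A q N| by rewrite normr_gt0 qpoch_neq0.
rewrite -normr_gt0; apply: (@lt_le_trans _ _ (`|qpoch A q N| * 2^-1)).
  by rewrite mulr_gt0// invr_gt0 ltr0n.
apply: (@ge_cvgn_norm _ (qpoch A q)); first exact: qpoch_cvg.
near=> n; have /subnKC <- : (N <= n)%N by near: n; exact: nbhs_infty_ge.
rewrite qpochD normrM ler_wpM2l//.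
by have /andP[] := qpoch_small_bounds (n - N) q1 AN.
Unshelve. all: by end_near. Qed.

End Convergence.
End Pochhammer.

(** * Power series solving a first order q-difference equation *)

Section PowerSeries.
Local Open Scope classical_set_scope.
Context {K : numFieldType}.
Implicit Types (q A B M N x r C F : K) (c d e : nat -> K).

Definition pseval c x : K := csum (fun n => c n * x ^+ n).

(** These are the relations between the coefficients of a power series [f]
    with [f 0 = 1] that express the functional equation
    [(1 - A x) (1 - B x) f x = (1 - M x) (1 - N x) f (q x)], solved by the
    quotient of [(M x, N x; q)_oo] by [(A x, B x; q)_oo]. *)
Definition qdiff_coef q A B M N c : Prop :=
  [/\ c 0%N = 1,
      c 1%N - (A + B) = q * c 1%N - (M + N) &
      forall n, c n.+2 - (A + B) * c n.+1 + A * B * c n =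
        q ^+ n.+2 * c n.+2 - (M + N) * (q ^+ n.+1 * c n.+1)
        + M * N * (q ^+ n * c n)].

Lemma abs_summable_pow d C x :
  (forall n, `|d n| <= C) -> `|x| < 1 -> abs_summable (fun n => d n * x ^+ n).
Proof.
by move=> dC x1; apply: (abs_summableMbounded dC); exact: abs_summable_geometric.
Qed.

Lemma power_series_tail d C x r S m :
  (forall n, `|d n| <= C) -> `|x| <= r -> r < 1 ->
  series (fun n => d n * x ^+ n) @ \oo --> S ->
  `|S - \sum_(0 <= n < m) d n * x ^+ n| <= C * `|x| ^+ m / (1 - r).
Proof.
move=> dC xr r1 dS; have C0 : 0 <= C by rewrite (le_trans _ (dC 0%N)).
have x1 : `|x| < 1 := le_lt_trans xr r1.
apply: (norm_cvgn_le dS); near=> n.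
have mn : (m <= n)%N by near: n; exact: nbhs_infty_ge.
rewrite /series/= (big_cat_nat (leq0n m) mn)//= addrAC subrr add0r.
rewrite -{1}[m]add0n big_addn (le_trans (ler_norm_sum _ _ _))//.
apply: (@le_trans _ _ (\sum_(0 <= i < n - m) C * `|x| ^+ m * `|x| ^+ i)).
  apply: ler_sum => i _; rewrite normrM normrX addnC exprD mulrA.
  by rewrite !ler_wpM2r ?exprn_ge0.
rewrite -mulr_sumr ler_wpM2l ?mulr_ge0 ?exprn_ge0//.
rewrite (le_trans (geometric_sum_le _ x1))// lef_pV2 ?posrE ?subr_gt0//.
by rewrite lerD2l lerN2.
Unshelve. all: by end_near. Qed.

Section FixedBase.
Context (q : K) (q1 : `|q| < 1) (hK : abs_complete K).

Lemma norm_qpowS_le k : `|q ^+ k.+1| <= `|q|.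
Proof. by rewrite normrX exprS ler_piMr// exprn_ile1// ltW. Qed.

Lemma qdiff_coef_scale A B M N c s : qdiff_coef q A B M N c ->
  qdiff_coef q (A * s) (B * s) (M * s) (N * s) (fun n => c n * s ^+ n).
Proof.
move=> [c0 c1 cS]; split => [|/=|n /=].
- by rewrite expr0 mulr1.
- rewrite expr1; transitivity ((c 1%N - (A + B)) * s); first by ring.
  by rewrite c1; ring.
- transitivity ((c n.+2 - (A + B) * c n.+1 + A * B * c n) * s ^+ n.+2).
    by rewrite !exprS; ring.
  by rewrite cS !exprS; ring.
Qed.

(** The functional equation at 1 holds between partial sums of shifted length,
    which makes it available as soon as the two series converge, even
    conditionally. *)
Lemma qdiff_partial_sums A B M N c n : qdiff_coef q A B M N c ->
  let S := series c in let T := series (fun n => c n * q ^+ n) in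
  S n.+2 - (A + B) * S n.+1 + A * B * S n
  = T n.+2 - (M + N) * T n.+1 + M * N * T n.
Proof.
move=> [c0 c1 cS] /=; elim: n => [|n IH].
  rewrite /series/= !big_nat_recr//= !big_geq//= !add0r !mulr0 !addr0 c0 expr0 expr1.
  transitivity (1 + (c 1%N - (A + B))); first by ring.
  by rewrite c1; ring.
move: IH; set S := series c; set T := series _ => IH.
have SS m : S m.+1 = S m + c m by rewrite /S /series/= big_nat_recr.
have TS m : T m.+1 = T m + c m * q ^+ m by rewrite /T /series/= big_nat_recr.
transitivity (S n.+2 - (A + B) * S n.+1 + A * B * S n
   + (c n.+2 - (A + B) * c n.+1 + A * B * c n)).
  by rewrite (SS n.+2) (SS n.+1) (SS n); ring.
by rewrite IH cS (TS n.+2) (TS n.+1) (TS n); ring.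
Qed.

Lemma qdiff_sum A B M N c F F' : qdiff_coef q A B M N c ->
  series c @ \oo --> F -> series (fun n => c n * q ^+ n) @ \oo --> F' ->
  (1 - A) * (1 - B) * F = (1 - M) * (1 - N) * F'.
Proof.
move=> cP cF cF'.
have lim A' B' u l : u @ \oo --> l ->
    (fun n => u n.+2 - (A' + B') * u n.+1 + A' * B' * u n) @ \oo
      --> (1 - A') * (1 - B') * l.
  move=> ul; have -> : (1 - A') * (1 - B') * l = l - (A' + B') * l + A' * B' * l by ring.
  apply: cvgD; last by apply: cvgM => //; exact: cvg_cst.
  apply: cvgB; first by apply: (@cvgnS _ (fun n => u n.+1)); exact: cvgnS.
  by apply: cvgM; [exact: cvg_cst|exact: cvgnS].
apply: (cvgn_unique (lim A B _ _ cF)).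
under eq_fun do rewrite (qdiff_partial_sums _ cP).
exact: lim.
Qed.

Section Grid.
Context (c : nat -> K) (C : K) (cC : forall n, `|c n| <= C).

Lemma pseval_cvgS k :
  series (fun n => c n * (q ^+ k.+1) ^+ n) @ \oo --> pseval c (q ^+ k.+1).
Proof.
apply: (abs_summable_cvg hK); apply: (abs_summable_pow cC).
exact: le_lt_trans (norm_qpowS_le _) q1.
Qed.

Lemma pseval_expq_bounded : exists M, forall k, `|pseval c (q ^+ k)| <= M.
Proof.
apply: (@bounded_of_tail _ _ 1 (C / (1 - `|q|))) => -[//|k] _.
have := power_series_tail 0 cC (norm_qpowS_le k) q1 (pseval_cvgS (k := k)).
by rewrite big_geq// subr0 expr0 mulr1.
Qed.

Lemma pseval_expq_cvg1 : c 0%N = 1 ->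
  (fun k => pseval c (q ^+ k)) @ \oo --> (1 : K).
Proof.
move=> c0; rewrite -(cvg_shiftS (fun k => pseval c (q ^+ k))).
apply: (@squeeze0 _ _ (fun k => C * (1 - `|q|)^-1 * q ^+ k.+1)); last first.
  rewrite -(mulr0 (C * (1 - `|q|)^-1)); apply: cvgM; first exact: cvg_cst.
  by apply: (@cvgnS _ (fun k => q ^+ k)); exact: cvgn_expr.
move=> k /=; have := power_series_tail 1 cC (norm_qpowS_le k) q1 (pseval_cvgS (k := k)).
rewrite big_nat1 c0 mul1r expr0 expr1 => /le_trans; apply.
rewrite mulrAC -[leLHS]ger0_norm ?normrM ?normr_id//.
have C0 : 0 <= C by rewrite (le_trans _ (cC 0%N)).
by rewrite !mulr_ge0// invr_ge0 subr_ge0 ltW.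
Qed.

Lemma pseval_cvg (cS : csummable c) k :
  series (fun n => c n * (q ^+ k) ^+ n) @ \oo --> pseval c (q ^+ k).
Proof.
case: k => [|k]; last exact: pseval_cvgS.
rewrite /pseval (_ : (fun n => c n * _) = c); first exact: cS.
by apply/funext => n; rewrite expr0 expr1n mulr1.
Qed.

Lemma pseval_expq0 : pseval c (q ^+ 0) = csum c.
Proof. by congr csum; apply/funext => n; rewrite expr0 expr1n mulr1. Qed.

Context (A B M N : K) (cP : qdiff_coef q A B M N c) (cS : csummable c).

Lemma qdiff_csum_qpoch k :
  csum c * qpoch A q k * qpoch B q k
  = qpoch M q k * qpoch N q k * pseval c (q ^+ k).
Proof.
elim: k => [|k IH]; first by rewrite !qpoch0 pseval_expq0; ring.
have := qdiff_sum (qdiff_coef_scale (q ^+ k) cP) (pseval_cvg cS (k := k)).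
have cSk : series (fun n => c n * (q ^+ k) ^+ n * q ^+ n) @ \oo
    --> pseval c (q ^+ k.+1).
  rewrite (_ : (fun _ => _) = fun n => c n * (q ^+ k.+1) ^+ n).
    exact: pseval_cvg.
  by apply/funext => n; rewrite exprSr exprMn mulrA.
move=> /(_ _ cSk) E; rewrite !qpochS.
transitivity ((1 - A * q ^+ k) * (1 - B * q ^+ k)
              * (csum c * qpoch A q k * qpoch B q k)); first by ring.
transitivity (qpoch M q k * qpoch N q k
   * ((1 - A * q ^+ k) * (1 - B * q ^+ k) * pseval c (q ^+ k))).
  by rewrite IH; ring.
by rewrite E; ring.
Qed.

(** Iterating the functional equation moves the argument from 1 to [q ^+ k],
    where the value tends to that at 0. *)
Lemma qdiff_csum_qpochoo :
  csum c * qpochoo A q * qpochoo B q = qpochoo M q * qpochoo N q.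
Proof.
have lhs : (fun k => csum c * qpoch A q k * qpoch B q k) @ \oo
    --> csum c * qpochoo A q * qpochoo B q.
  by apply: cvgM; [apply: cvgM; [exact: cvg_cst|]|]; exact: qpoch_cvg.
apply: (cvgn_unique lhs).
under eq_fun do rewrite qdiff_csum_qpoch.
rewrite -(mulr1 (qpochoo M q * qpochoo N q)); apply: cvgM.
  by apply: cvgM; exact: qpoch_cvg.
by case: cP => c0 _ _; exact: pseval_expq_cvg1 c0.
Qed.

End Grid.

(** In the recurrence solved for [c n.+2], the divisor [1 - q ^+ n.+2] is at least
    [1 - |q|] in norm and the two other coefficients are bounded. *)
Lemma qdiff_coef_geometric_bound A B M N c : qdiff_coef q A B M N c ->
  exists2 C, 0 <= C & forall n, `|c n| <= C ^+ n.
Proof.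
move=> [c0 c1 cS].
have q10 : 0 < 1 - `|q| by rewrite subr_gt0.
pose P := `|A + B| + `|M + N| + (`|M * N| + `|A * B|).
have P0 : 0 <= P by rewrite !addr_ge0.
pose C := 1 + P / (1 - `|q|).
have C1 : 1 <= C by rewrite lerDl divr_ge0// ltW.
have C0 : 0 <= C by exact: le_trans ler01 C1.
have CP : P <= (1 - `|q|) * C.
  by rewrite mulrDr mulr1 mulrCA divff ?gt_eqF// mulr1 lerDr ltW.
have lead n y : (1 - `|q|) * `|y| <= `|(1 - q ^+ n.+1) * y|.
  rewrite normrM ler_wpM2r// (le_trans _ (lerB_dist _ _))// normr1.
  by rewrite lerD2l lerN2 norm_qpowS_le.
exists C => //; suff H n : `|c n| <= C ^+ n /\ `|c n.+1| <= C ^+ n.+1 by move=> n; case: (H n).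
elim: n => [|n [IH0 IH1]].
  rewrite c0 normr1; split=> //; rewrite expr1 -(ler_pM2l q10).
  rewrite (le_trans _ CP)// (le_trans (lead 0%N _))// expr1.
  have -> : (1 - q) * c 1%N = (A + B) - (M + N).
    by rewrite mulrBl mul1r -(subrK (A + B) (c 1%N)) {1}c1; ring.
  by rewrite (le_trans (ler_normB _ _))// lerDl addr_ge0.
split=> //; rewrite -(ler_pM2l q10) (le_trans (lead n.+1 _))//.
have -> : (1 - q ^+ n.+2) * c n.+2
    = ((A + B) - (M + N) * q ^+ n.+1) * c n.+1 + (M * N * q ^+ n - A * B) * c n.
  have /eqP := cS n; rewrite -subr_eq0 => /eqP E; apply/eqP; rewrite -subr_eq0 -E.
  by apply/eqP; ring.
have qn m : `|q ^+ m| <= 1 by rewrite normrX exprn_ile1// ltW.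
rewrite [C ^+ _.+2]exprS; apply: (@le_trans _ _ (P * C ^+ n.+1)); last first.
  by rewrite [leRHS]mulrA ler_wpM2r// exprn_ge0.
rewrite /P [leRHS]mulrDl (le_trans (ler_normD _ _))// !normrM lerD//.
  apply: ler_pM => //; rewrite (le_trans (ler_normB _ _))// lerD2l normrM.
  by rewrite ler_piMr.
apply: ler_pM => //.
  by rewrite (le_trans (ler_normB _ _))// !normrM lerD2r ler_piMr ?mulr_ge0.
by rewrite (le_trans IH0)// exprS ler_peMl// exprn_ge0.
Qed.

(** Factoring [(1 - A x) (1 - B x)] turns the second order recurrence into two
    first order ones of ratios A and B, whose source only involves the
    coefficients [c n * q ^+ n] of [f (q x)]. *)
Lemma qdiff_summable_step A B M N c : qdiff_coef q A B M N c ->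
  `|A| < 1 -> `|B| < 1 -> abs_summable (fun n => c n * q ^+ n) -> abs_summable c.
Proof.
move=> [c0 c1 cS] A1 B1 /[dup] s0 /abs_summable_shift /[dup] s1 /abs_summable_shift s2.
have e_summable : abs_summable (fun n => c n.+1 - B * c n).
  apply: (abs_summable_rec A1 (abs_summableD (abs_summableD s2
    (abs_summableZ (- (M + N)) s1)) (abs_summableZ (M * N) s0))) => n /=.
  have /eqP := cS n; rewrite -subr_eq0 => /eqP E; apply/eqP; rewrite -subr_eq0 -E.
  by apply/eqP; ring.
by apply: (abs_summable_rec B1 e_summable) => n /=; ring.
Qed.

(** By the geometric bound on the coefficients the series converges absolutely
    at [q ^+ j] for some j; the functional equation then brings it from there
    up to 1, one power of q at a time. *)
Lemma qdiff_abs_summable A B M N c : qdiff_coef q A B M N c ->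
  `|A| < 1 -> `|B| < 1 -> abs_summable c.
Proof.
move=> cP A1 B1; have [C C0 cC] := qdiff_coef_geometric_bound cP.
have [j qj] : exists j, `|C * q ^+ j| < 1.
  have /cvgrPdist_lt : (fun n => C * q ^+ n) @ \oo --> (0 : K).
    by rewrite -(mulr0 C); apply: cvgM; [exact: cvg_cst|exact: cvgn_expr].
  move=> /(_ 1 ltr01)[j _ /(_ j (leqnn j))]; rewrite /= sub0r normrN.
  by exists j.
have : abs_summable (fun n => c n * (q ^+ j) ^+ n).
  apply: abs_summable_le (abs_summable_geometric qj) => n.
  by rewrite exprMn !normrM ler_wpM2r// (le_trans (cC n))// normrX (ger0_norm C0).
clear C C0 cC qj; elim: j A B M N c cP A1 B1 => [|j IH] A B M N c cP A1 B1 cj.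
  by apply: abs_summable_le cj => n; rewrite expr0 expr1n mulr1.
apply: (qdiff_summable_step cP A1 B1).
apply: (IH _ _ _ _ _ (qdiff_coef_scale q cP)).
- by rewrite normrM mulr_ilt1.
- by rewrite normrM mulr_ilt1.
- by apply: abs_summable_le cj => n; rewrite exprS exprMn mulrA.
Qed.

(** ** Interchanging two such series *)

Section Swap.
Context (d e : nat -> K) (C : K) (dC : forall n, `|d n| <= C)
  (e0 : e 0%N = 1) (eS : abs_summable e).

Let D k := pseval d (q ^+ k).
Let Y n := pseval e (q ^+ n).

Let dD k : series (fun n => d n * (q ^+ k.+1) ^+ n) @ \oo --> D k.+1.
Proof. exact: pseval_cvgS dC _. Qed.

Let eY n : series (fun k => e k * (q ^+ n) ^+ k) @ \oo --> Y n.
Proof.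
by have [B eB] := abs_summable_bounded eS; exact: (pseval_cvg eB (hK eS)).
Qed.

(** For [f] with coefficients [d] and [g] with coefficients [e], both
    [sum_n d n * g (q ^+ n)] and [sum_k e k * f (q ^+ k)] are the iterated sums
    of [d n * e k * q ^+ (n * k)].  This double family need not be absolutely
    summable when [d] is only bounded, but it is once the terms with [k = 0] are
    removed; those contribute the plain series of [d].  Concretely, cutting the
    sums over n at m costs at most [C |q|^m / (1 - |q|)] for every [k > 0] at
    once. *)
Lemma swap_tail :
  series (fun n => d n * (Y n - 1)) @ \oo
    --> csum (fun k => D k.+1 * e k.+1).
Proof.
rewrite -e0.
have C0 : 0 <= C by rewrite (le_trans _ (dC 0%N)).
have q10 : 0 <= (1 - `|q|)^-1 by rewrite invr_ge0 subr_ge0 ltW.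
have tail k m : `|D k.+1 - \sum_(0 <= n < m) d n * (q ^+ k.+1) ^+ n|
    <= C * `|q| ^+ m / (1 - `|q|).
  apply: le_trans (power_series_tail m dC (norm_qpowS_le k) q1 (dD (k := k))) _.
  by rewrite ler_wpM2r// ler_wpM2l// lerXn2r ?nnegrE// norm_qpowS_le.
have [E eE] := abs_summable_shift eS.
pose w k := D k.+1 * e k.+1.
have wV : series w @ \oo --> csum w.
  apply: (abs_summable_cvg hK).
  apply: (abs_summableMbounded _ (abs_summable_shift eS)) => k.
  by have := tail k 0%N; rewrite big_geq// subr0; exact.
apply: (@squeeze0 _ _ (fun m => C / (1 - `|q|) * E * q ^+ m)); last first.
  rewrite -(mulr0 (C / (1 - `|q|) * E)); apply: cvgM; first exact: cvg_cst.
  exact: cvgn_expr.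
move=> m; rewrite distrC.
(* the finite sum over n may be exchanged with the series over k *)
pose v k := (\sum_(0 <= n < m) d n * (q ^+ k.+1) ^+ n) * e k.+1.
have vP : series v @ \oo --> series (fun n => d n * (Y n - e 0%N)) m.
  have := @csum_sum _ _ (index_iota 0 m) d
    (fun n k => e k.+1 * (q ^+ n) ^+ k.+1) (fun n => Y n - e 0%N).
  have -> : (fun k => \sum_(n <- index_iota 0 m) d n * (e k.+1 * (q ^+ n) ^+ k.+1)) = v.
    apply/funext => k; rewrite /v mulr_suml; apply: eq_bigr => n _.
    by rewrite -!exprM mulnC; ring.
  by apply=> n; have := csum_shift (eY (n := n)); rewrite expr0 mulr1.
have wvP : series (fun k => w k - v k) @ \oo
    --> csum w - series (fun n => d n * (Y n - e 0%N)) m.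
  rewrite (_ : series _ = fun n => series w n - series v n).
    exact: cvgB.
  by apply/funext => n; rewrite /series/= sumrB.
apply: (@le_trans _ _ (C * `|q| ^+ m / (1 - `|q|) * E)).
  apply: (csum_le wvP) => n.
  apply: (@le_trans _ _ (\sum_(0 <= i < n)
      C * `|q| ^+ m / (1 - `|q|) * `|e i.+1|)).
    by apply: ler_sum => i _; rewrite /w /v -mulrBl normrM ler_wpM2r.
  by rewrite -mulr_sumr ler_wpM2l// !mulr_ge0// exprn_ge0.
rewrite !normrM normrX -[leLHS]ger0_norm ?mulr_ge0 ?exprn_ge0//.
  rewrite !normrM normrX normr_id le_eqVlt; apply/orP; left; apply/eqP; ring.
exact: abs_summable_ge0 eE.
Qed.

Lemma pseval_weighted_cvg :
  series (fun k => D k * e k) @ \oo --> csum (fun k => D k * e k).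
Proof.
have [B DB] := pseval_expq_bounded dC.
exact/(abs_summable_cvg hK)/(abs_summableMbounded DB).
Qed.

Let series_split n : series (fun n => d n * Y n) n
  = series d n + series (fun n => d n * (Y n - 1)) n.
Proof.
by rewrite /series/= -big_split/=; apply: eq_bigr => i _; ring.
Qed.

Lemma swap_cvg : csummable d ->
  series (fun n => d n * Y n) @ \oo --> csum (fun k => D k * e k).
Proof.
move=> dS.
have := csum_shift pseval_weighted_cvg.
rewrite e0 mulr1 /D pseval_expq0 -/D => DeS1.
have E : csum (fun k => D k.+1 * e k.+1) = csum (fun k => D k * e k) - csum d.
  exact: norm_cvg_lim DeS1.
have -> : csum (fun k => D k * e k) = csum d + csum (fun k => D k.+1 * e k.+1).
  by rewrite E; ring.
rewrite (_ : series _ = fun n => series d n + series (fun n => d n * (Y n - 1)) n).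
  by apply: cvgD; [exact: dS|exact: swap_tail].
by apply/funext => n; exact: series_split.
Qed.

(** The difference of the two series is the one of [swap_tail], which converges
    in any case. *)
Lemma csummable_swap : csummable (fun n => d n * Y n) -> csummable d.
Proof.
move=> dY; rewrite /csummable (_ : series d = fun n => series (fun n => d n * Y n) n
    - series (fun n => d n * (Y n - 1)) n).
  by apply: is_cvgB => //; apply/cvg_ex; eexists; exact: swap_tail.
by apply/funext => n; rewrite series_split addrK.
Qed.

End Swap.

End FixedBase.
End PowerSeries.

(** * The q-binomial theorem *)

Section QBinomial.
Local Open Scope classical_set_scope.
Context {K : numFieldType} (hK : abs_complete K).
Context (q : K) (q0 : q != 0) (q1 : `|q| < 1).

Lemma qexpS_neq1 k : q ^+ k.+1 != 1.
Proof.
apply/eqP => E; have := norm_qpowS_le q1 k; rewrite E normr1.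
by move=> /le_lt_trans/(_ q1); rewrite ltxx.
Qed.

Definition qbinomial_coef (A x : K) (k : nat) : K :=
  qpoch A q k / qpoch q q k * x ^+ k.

Lemma qpoch_base_neq0 (p : K) k : (forall k, p ^+ k.+1 != 1) -> qpoch p p k != 0.
Proof.
by move=> pn1; apply/prodf_neq0 => i _; rewrite -exprS subr_eq0 eq_sym.
Qed.

(** The q-binomial series is the case [B = N = 0] of the functional equation. *)
Lemma qbinomial_coefP A x :
  qdiff_coef q x 0 (A * x) 0 (qbinomial_coef A x).
Proof.
have f k : 1 - q * q ^+ k != 0 by rewrite -exprS subr_eq0 eq_sym qexpS_neq1.
have f0 : 1 - q != 0 by have := f 0%N; rewrite expr0 mulr1.
have qdiff1 : qdiff_coef q 1 0 A 0 (fun k => qpoch A q k / qpoch q q k).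
  split=> [||n].
  - by rewrite !qpoch0 divr1.
  - by rewrite !qpochS !qpoch0 !expr0; field.
  - rewrite !qpochS !exprS; field.
    rewrite f (qpoch_base_neq0 _ qexpS_neq1)/=.
    by have := f n.+1; rewrite exprS.
by have := qdiff_coef_scale x qdiff1; rewrite mul1r !mul0r.
Qed.

Context (A x : K) (x1 : `|x| < 1).

Lemma qbinomial_abs_summable : abs_summable (qbinomial_coef A x).
Proof.
by apply: (qdiff_abs_summable q1 hK (qbinomial_coefP A x)); rewrite ?normr0 ?ltr01.
Qed.

Lemma qbinomial_bounded : exists C, forall k, `|qbinomial_coef A x k| <= C.
Proof. exact: abs_summable_bounded qbinomial_abs_summable. Qed.

Lemma qbinomial_qpoch n :
  csum (qbinomial_coef A x) * qpoch x q n
  = qpoch (A * x) q n * pseval (qbinomial_coef A x) (q ^+ n).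
Proof.
have [C eC] := qbinomial_bounded.
have := qdiff_csum_qpoch q1 hK eC (qbinomial_coefP A x)
  (hK qbinomial_abs_summable) n.
by rewrite !qpoch_base0 !mulr1.
Qed.

Lemma qbinomial_theorem :
  csum (qbinomial_coef A x) * qpochoo x q = qpochoo (A * x) q.
Proof.
have [C eC] := qbinomial_bounded.
have := qdiff_csum_qpochoo q1 hK eC (qbinomial_coefP A x)
  (hK qbinomial_abs_summable).
have -> : qpochoo 0 q = 1.
  apply: norm_cvg_lim; rewrite (_ : qpoch 0 q = fun=> 1); first exact: cvg_cst.
  by apply/funext => n; rewrite qpoch_base0.
by rewrite !mulr1.
Qed.

End QBinomial.

(** * Al-Salam--Chihara polynomials *)

Section AlSalamChihara.
Local Open Scope classical_set_scope.
Context {K : numFieldType}.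
Implicit Types (a b p q z X : K) (n k : nat).

Lemma qpoch_neg_eq0 p n k : p != 0 -> (n < k)%N -> qpoch (p ^- n) p k = 0.
Proof.
move=> p0 nk; rewrite /qpoch (bigD1 (Ordinal nk))//=.
by rewrite mulVf ?expf_neq0// subrr mul0r.
Qed.

Definition ASC_coef a b p n k : K :=
  qpoch (p ^- n) p k * qpoch (a * b * p ^+ k) p (n - k) / qpoch p p k.

(** Multiplication by [a (z + z^-1)] is two-term on these products, see
    [ASC_basis_rec]; the recurrence in the degree then becomes an identity
    between coefficients. *)
Definition ASC_basis a z p k : K := qpoch (a * z) p k * qpoch (a * z^-1) p k.

Lemma ASC_nzE n z a b p :
  ASC_nz n z a b p = a ^- n *
    \sum_(0 <= k < n.+1) ASC_coef a b p n k * p ^+ k * ASC_basis a z p k.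
Proof.
rewrite /ASC_nz big_mkord; congr (_ * _); apply: eq_bigr => k _.
by rewrite /ASC_coef /ASC_basis; ring.
Qed.

Section Recurrence.
Context (p : K) (p0 : p != 0) (pn1 : forall k, p ^+ k.+1 != 1).

Lemma ASC_coef_eq0 a b n k : (n < k)%N -> ASC_coef a b p n k = 0.
Proof. by move=> nk; rewrite /ASC_coef qpoch_neg_eq0// !mul0r. Qed.

(** Together with [ASC_coef_recS]: the coefficients of [ASC_basis] on both sides
    of the three-term recurrence agree. *)
Lemma ASC_coef_rec0 a b n :
  ASC_coef a b p n.+2 0 =
    ASC_coef a b p n.+1 0 * (1 + a ^+ 2 - a * (a + b) * p ^+ n.+1)
    - a ^+ 2 * (1 - p ^+ n.+1) * (1 - a * b * p ^+ n) * ASC_coef a b p n 0.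
Proof.
by rewrite /ASC_coef !qpoch0 !subn0 expr0 mulr1 !qpochS !exprS; field.
Qed.

Lemma ASC_coef_recS a b n j : (j <= n.+1)%N ->
  ASC_coef a b p n.+2 j.+1 * p ^+ j.+1 =
    ASC_coef a b p n.+1 j.+1
      * (1 + a ^+ 2 * p ^+ j.+1 ^+ 2 - a * (a + b) * p ^+ n.+1 * p ^+ j.+1)
    - ASC_coef a b p n.+1 j
    - a ^+ 2 * (1 - p ^+ n.+1) * (1 - a * b * p ^+ n)
      * ASC_coef a b p n j.+1 * p ^+ j.+1.
Proof.
have pj0 : p ^+ j != 0 by exact: expf_neq0.
have pn0 : p ^+ n != 0 by exact: expf_neq0.
have pj1 : 1 - p * p ^+ j != 0 by rewrite -exprS subr_eq0 eq_sym.
have G0 := qpoch_base_neq0 j pn1.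
have up : qpoch (p ^- n.+2) p j.+1 = (1 - p ^- n.+2) * qpoch (p ^- n.+1) p j.
  rewrite qpochSl; congr (_ * qpoch _ _ _).
  by rewrite [p ^+ n.+2]exprS invfM mulrAC mulVf// mul1r.
rewrite leq_eqVlt => /orP[/eqP jn|].
  (* at the top index only the shifted coefficient of degree n.+1 survives *)
  subst j; rewrite (@ASC_coef_eq0 _ _ n.+1)// (@ASC_coef_eq0 _ _ n)//.
  rewrite /ASC_coef !subnn !qpoch0 up [qpoch p p n.+2]qpochS [p ^+ n.+2]exprS.
  rewrite !mulr1 !mul0r !mulr0 !mul0r; field.
  by rewrite G0 pj1 pj0 p0.
rewrite ltnS => jn.
set E := qpoch (p ^- n.+1) p j; pose D := qpoch (a * b * p ^+ j.+1) p (n - j).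
have cur : qpoch (p ^- n.+1) p j.+1 = E * (1 - p ^- n.+1 * p ^+ j) by exact: qpochS.
(* both sides vanish when j = n, where n - j.+1 is a truncated subtraction *)
have low : (1 - p ^+ n.+1) * (1 - a * b * p ^+ n) * ASC_coef a b p n j.+1
    = - p ^+ n.+1 * (E * (1 - p ^- n.+1 * p ^+ j) * (1 - p ^- n.+1 * p ^+ j.+1))
      * D / (qpoch p p j * (1 - p * p ^+ j)).
  have lowE : (1 - p ^- n.+1) * qpoch (p ^- n) p j.+1
      = E * (1 - p ^- n.+1 * p ^+ j) * (1 - p ^- n.+1 * p ^+ j.+1).
    rewrite -cur -qpochS [RHS]qpochSl; congr (_ * qpoch _ _ _).
    by rewrite [p ^+ n.+1]exprS invfM mulrAC mulVf// mul1r.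
  move: jn; rewrite leq_eqVlt => /orP[/eqP jn|jn].
    by rewrite ASC_coef_eq0 ?jn// mulVf ?expf_neq0// subrr !(mulr0, mul0r).
  rewrite -lowE /ASC_coef [qpoch p p _]qpochS.
  have -> : D = (1 - a * b * p ^+ n) * qpoch (a * b * p ^+ j.+1) p (n - j.+1).
    by rewrite /D -(subnSK jn) qpochS -[a * b * _ * _]mulrA -exprD subnKC// mulrC.
  rewrite [p ^+ n.+1]exprS; field.
  by rewrite pn0 p0 pj1 G0.
have up2 : qpoch (a * b * p ^+ j.+1) p (n.+2 - j.+1) = D * (1 - a * b * p ^+ n.+1).
  by rewrite subSS subSn// qpochS -[a * b * _ * _]mulrA -exprD addSn subnKC.
have cur2 : qpoch (a * b * p ^+ j) p (n.+1 - j) = (1 - a * b * p ^+ j) * D.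
  by rewrite subSn// qpochSl -[a * b * _ * _]mulrA -exprSr.
rewrite -(mulrA (a ^+ 2)) -(mulrA (a ^+ 2)) low /ASC_coef up up2 cur cur2 subSS.
rewrite -/D -/E qpochS !exprS; field.
by rewrite pn0 p0 pj1 G0.
Qed.

Lemma ASC_basis_rec a z j : a != 0 -> z != 0 ->
  a * (z + z^-1) * p ^+ j * ASC_basis a z p j
  = (1 + a ^+ 2 * p ^+ j ^+ 2) * ASC_basis a z p j - ASC_basis a z p j.+1.
Proof. by move=> a0 z0; rewrite /ASC_basis !qpochS; field. Qed.

Lemma ASC_nz_rec n z a b : a != 0 -> z != 0 ->
  ASC_nz n.+2 z a b p =
    (z + z^-1 - (a + b) * p ^+ n.+1) * ASC_nz n.+1 z a b p
    - (1 - p ^+ n.+1) * (1 - a * b * p ^+ n) * ASC_nz n z a b p.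
Proof.
move=> a0 z0; set X := z + z^-1.
pose phi := ASC_basis a z p.
pose S m := \sum_(0 <= k < m.+1) ASC_coef a b p m k * p ^+ k * phi k.
have ext m : S m = \sum_(0 <= k < m.+2) ASC_coef a b p m k * p ^+ k * phi k.
  by rewrite [RHS]big_nat_recr//= ASC_coef_eq0// !mul0r addr0.
have ext2 m : S m = \sum_(0 <= k < m.+3) ASC_coef a b p m k * p ^+ k * phi k.
  by rewrite [RHS]big_nat_recr//= ASC_coef_eq0// !mul0r addr0 -ext.
have XS : a * X * S n.+1 = \sum_(0 <= k < n.+3)
    (ASC_coef a b p n.+1 k * (1 + a ^+ 2 * p ^+ k ^+ 2)
     - (if k is j.+1 then ASC_coef a b p n.+1 j else 0)) * phi k.
  transitivity (\sum_(0 <= k < n.+2)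
      (ASC_coef a b p n.+1 k * (1 + a ^+ 2 * p ^+ k ^+ 2) * phi k
       - ASC_coef a b p n.+1 k * phi k.+1)).
    rewrite mulr_sumr; apply: eq_bigr => k _.
    transitivity (ASC_coef a b p n.+1 k * (a * X * p ^+ k * phi k)); first by ring.
    by rewrite ASC_basis_rec//; rewrite /phi; ring.
  under [RHS]eq_bigr do rewrite mulrBl.
  rewrite !sumrB; congr (_ - _).
    by rewrite [RHS]big_nat_recr//= ASC_coef_eq0// !mul0r addr0.
  by rewrite [RHS]big_nat_recl//= mul0r add0r.
have SE : S n.+2 = (a * X - a * (a + b) * p ^+ n.+1) * S n.+1
    - a ^+ 2 * (1 - p ^+ n.+1) * (1 - a * b * p ^+ n) * S n.
  rewrite mulrBl XS (ext2 n) (ext n.+1) !mulr_sumr -!sumrB /S.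
  rewrite [LHS]big_nat_cond [RHS]big_nat_cond; apply: eq_bigr => -[|j] /andP[/andP[_ jn] _].
    by rewrite ASC_coef_rec0 expr0; ring.
  by rewrite ASC_coef_recS//; ring.
rewrite !ASC_nzE -/(S n.+2) -/(S n.+1) -/(S n) SE !exprS; field.
by rewrite a0 expf_neq0.
Qed.

Lemma ASC_nz0 z a b : ASC_nz 0 z a b p = 1.
Proof.
by rewrite ASC_nzE big_nat1 /ASC_coef /ASC_basis !qpoch0; field.
Qed.

Lemma ASC_nz1 z a b : a != 0 -> z != 0 ->
  ASC_nz 1 z a b p = z + z^-1 - (a + b).
Proof.
move=> a0 z0; have p1 : 1 - p != 0 by rewrite subr_eq0 eq_sym; exact: (pn1 0).
rewrite ASC_nzE big_nat_recr//= big_nat1 /ASC_coef /ASC_basis.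
rewrite !qpochS !qpoch0 !expr1 !expr0 !mulr1 !mul1r; field.
by rewrite a0 z0 p0 p1.
Qed.

(** Unlike the explicit sum, the recurrence makes sense at [a = 0] and is
    visibly continuous in [a]. *)
Fixpoint ASC_rec (X a b : K) n : K :=
  if n is n1.+1 then
    if n1 is n0.+1 then
      (X - (a + b) * p ^+ n1) * ASC_rec X a b n1
      - (1 - p ^+ n1) * (1 - a * b * p ^+ n0) * ASC_rec X a b n0
    else X - (a + b)
  else 1.

Lemma ASC_nz_recE n z a b : a != 0 -> z != 0 ->
  ASC_nz n z a b p = ASC_rec (z + z^-1) a b n.
Proof.
move=> a0 z0; suff : ASC_nz n z a b p = ASC_rec (z + z^-1) a b n /\
    ASC_nz n.+1 z a b p = ASC_rec (z + z^-1) a b n.+1 by case.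
elim: n => [|n [IH0 IH1]]; first by rewrite ASC_nz0 ASC_nz1.
by split=> //; rewrite ASC_nz_rec// IH0 IH1.
Qed.

Lemma ASC_rec_cvg0 X b n :
  ASC_rec X c b n @[c --> (0 : K)^'] --> ASC_rec X 0 b n.
Proof.
suff : ASC_rec X c b n @[c --> (0 : K)^'] --> ASC_rec X 0 b n /\
    ASC_rec X c b n.+1 @[c --> (0 : K)^'] --> ASC_rec X 0 b n.+1 by case.
have c0 : c @[c --> (0 : K)^'] --> (0 : K) by exact: cvg_within.
have cst (k : K) : k @[c --> (0 : K)^'] --> k by exact: cvg_cst.
elim: n => [|n [IH0 IH1]].
  by split=> /=; [exact: cst|apply: cvgB => //; apply: cvgD].
split=> //; apply: cvgB; apply: cvgM => //.
  by apply: cvgB => //; apply: cvgM => //; apply: cvgD.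
by apply: cvgM => //; apply: cvgB => //; apply: cvgM => //; apply: cvgM.
Qed.

Lemma ASC_zE n z a b : z != 0 -> ASC_z n z a b p = ASC_rec (z + z^-1) a b n.
Proof.
move=> z0; rewrite /ASC_z; case: ifPn => [/eqP->|a0]; last exact: ASC_nz_recE.
have zc := @ASC_rec_cvg0 (z + z^-1) b n.
apply: norm_cvg_lim; apply: (cvg_trans _ zc).
apply: near_eq_cvg; near=> c; rewrite ASC_nz_recE//.
by near: c; exact: nbhs_dnbhs_neq.
Unshelve. all: by end_near. Qed.

End Recurrence.

(** Coefficients of the generating function
    [(- z s, - s / z; q)_oo / (- a s, - b s; q)_oo] in the variable s. *)
Definition ASC_genf_coef q z a b n : K :=
  q ^+ 'C(n, 2) / qpoch q q n * ASC_z n z a b q^-1.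

(** In base 1/q the three-term recurrence loses its negative powers of q once
    it is multiplied by those in the normalisation. *)
Lemma ASC_genf_coefP q z a b :
  q != 0 -> (forall k, q ^+ k.+1 != 1) -> z != 0 ->
  qdiff_coef q (- a) (- b) (- z) (- z^-1) (ASC_genf_coef q z a b).
Proof.
move=> q0 qn1 z0; have qV0 : q^-1 != 0 by rewrite invr_eq0.
have qVn1 k : q^-1 ^+ k.+1 != 1 by rewrite exprVn invr_eq1.
have E n := ASC_zE qV0 qVn1 n a b z0.
have f k : 1 - q * q ^+ k != 0 by rewrite -exprS subr_eq0 eq_sym.
have f0 : 1 - q != 0 by have := f 0%N; rewrite expr0 mulr1.
rewrite /ASC_genf_coef; split=> [||n]; rewrite !E.
- by rewrite qpoch0 /= bin_small// expr0; field.
- by rewrite qpochS qpoch0 /= bin_small// expr0; field; rewrite z0 f0.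
have -> : ASC_rec q^-1 (z + z^-1) a b n.+2 =
  (z + z^-1 - (a + b) * q^-1 ^+ n.+1) * ASC_rec q^-1 (z + z^-1) a b n.+1
   - (1 - q^-1 ^+ n.+1) * (1 - a * b * q^-1 ^+ n) * ASC_rec q^-1 (z + z^-1) a b n by [].
set Q1 := ASC_rec _ _ _ _ n.+1; set Q0 := ASC_rec _ _ _ _ n.
have bS m : q ^+ 'C(m.+1, 2) = q ^+ 'C(m, 2) * q ^+ m.
  by rewrite binS bin1 exprD.
rewrite !bS !qpochS !exprVn !exprS; field.
rewrite z0 q0 expf_neq0 ?f ?(qpoch_base_neq0 _ qn1)//=.
by have := f n.+1; rewrite exprS.
Qed.

End AlSalamChihara.

(** * The transformation formula *)

Section Transformation.
Local Open Scope classical_set_scope.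
Context {K : numFieldType} (hK : abs_complete K).
Context (q : K) (q0 : q != 0) (q1 : `|q| < 1).

(** With [d] the coefficients of the Al-Salam--Chihara generating function scaled
    by t, and [Y n] the q-binomial series at [q ^+ n], the n-th term is
    [d n * Y n / Y 0]; all nonvanishing statements serve the divisions in the
    final comparison. *)
Lemma ASC_transform z a b t gamma delta :
  let u n := q ^+ 'C(n, 2) * t ^+ n * qpoch gamma q n
    / (qpoch q q n * qpoch delta q n) * ASC_z n z a b q^-1 in
  z != 0 -> 0 < `|gamma| < 1 ->
  ~ Omega q delta -> ~ Omega q (- t * z) -> ~ Omega q (- t * z^-1) ->
  ~ Omega q (- a * t) -> ~ Omega q (- b * t) ->
  (`|a * t| < 1 -> `|b * t| < 1 -> csummable u) /\
  (csummable u ->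
   csum u =
     (qpochoo gamma q * qpochoo (- t * z) q * qpochoo (- t * z^-1) q)
     / (qpochoo delta q * qpochoo (- a * t) q * qpochoo (- b * t) q)
     * phi32 (delta / gamma) (- a * t) (- b * t) (- t * z) (- t * z^-1)
         q gamma).
Proof.
move=> u z0 /andP[g0 g1] dO mO nO aO bO.
have gn0 : gamma != 0 by rewrite -normr_gt0.
have gO : ~ Omega q gamma by exact: Omega_norm_lt1.
have qn0 k : qpoch q q k != 0 := qpoch_base_neq0 k (qexpS_neq1 q1).
pose d n := ASC_genf_coef q z a b n * t ^+ n.
have dP : qdiff_coef q (- a * t) (- b * t) (- t * z) (- t * z^-1) d.
  have := qdiff_coef_scale t (ASC_genf_coefP a b q0 (qexpS_neq1 q1) z0).
  by rewrite !mulNr !(mulrC t).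
pose e := qbinomial_coef q (delta / gamma) gamma.
have e0 : e 0%N = 1 by case: (qbinomial_coefP q1 (delta / gamma) gamma).
have eS : abs_summable e by exact: qbinomial_abs_summable.
pose Y n := pseval e (q ^+ n).
have Ypoch n : csum e * qpoch gamma q n = qpoch delta q n * Y n.
  by rewrite (qbinomial_qpoch hK q1 _ g1) divfK.
have Ypochoo : csum e * qpochoo gamma q = qpochoo delta q.
  by rewrite (qbinomial_theorem hK q1 _ g1) divfK.
have goo0 : qpochoo gamma q != 0 by exact: qpochoo_neq0.
have doo0 : qpochoo delta q != 0 by exact: qpochoo_neq0.
have Y00 : csum e != 0 by apply: contra_neq doo0; rewrite -Ypochoo => ->; rewrite mul0r.
have gn n : qpoch gamma q n != 0 by exact: qpoch_neq0.
have dn n : qpoch delta q n != 0 by exact: qpoch_neq0.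
have Yn0 n : Y n != 0.
  have := mulf_neq0 Y00 (gn n); rewrite Ypoch.
  by apply: contra_neq => ->; rewrite mulr0.
have uE n : u n = (csum e)^-1 * (d n * Y n).
  have -> : Y n = csum e * qpoch gamma q n / qpoch delta q n.
    by rewrite Ypoch mulrAC divff// mul1r.
  by rewrite /u /d /ASC_genf_coef; field; rewrite dn Y00 qn0.
have usum : series u = fun n => (csum e)^-1 * series (fun n => d n * Y n) n.
  by apply/funext => n; rewrite /series/= mulr_sumr; apply: eq_bigr => i _.
split.
  move=> at1 bt1.
  have dS : abs_summable d.
    by apply: (qdiff_abs_summable q1 hK dP); rewrite mulNr normrN.
  have [C dC] := abs_summable_bounded dS.
  have dYcv := swap_cvg q1 hK dC e0 eS (hK dS).
  rewrite /csummable usum; apply/cvg_ex; eexists.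
  by apply: cvgM; [exact: cvg_cst|exact: dYcv].
move=> uS.
have dYcv : csummable (fun n => d n * Y n).
  rewrite /csummable (_ : series _ = fun n => csum e * series u n).
    by apply: is_cvgM => //; exact: is_cvg_cst.
  by apply/funext => n; rewrite usum mulrA divff// mul1r.
(* the terms [d n * Y n] tend to 0 and [Y n] to 1 *)
have [C dC] : exists C, forall n, `|d n| <= C.
  have [B eB] := abs_summable_bounded eS.
  have Y1 : Y @ \oo --> (1 : K) := pseval_expq_cvg1 q1 hK eB e0.
  have : (fun n => d n * Y n * (Y n)^-1) @ \oo --> (0 * 1^-1 : K).
    apply: cvgM; first exact: (cvg_series_cvg_0 dYcv).
    by apply: cvgV => //; exact: oner_neq0.
  move=> /cvgn_bounded[C dC]; exists C => n.
  by have := dC n; rewrite mulfK.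
have dcv : csummable d := csummable_swap q1 hK dC e0 eS dYcv.
pose D k := pseval d (q ^+ k).
have D0E := qdiff_csum_qpochoo q1 hK dC dP dcv.
have aoo0 : qpochoo (- a * t) q != 0 by exact: qpochoo_neq0.
have boo0 : qpochoo (- b * t) q != 0 by exact: qpochoo_neq0.
have moo0 : qpochoo (- t * z) q != 0 by exact: qpochoo_neq0.
have noo0 : qpochoo (- t * z^-1) q != 0 by exact: qpochoo_neq0.
have D00 : csum d != 0.
  have := mulf_neq0 moo0 noo0; rewrite -D0E.
  by apply: contra_neq => ->; rewrite !mul0r.
pose L := csum (fun k => D k * e k).
have dYL := swap_cvg q1 hK dC e0 eS dcv.
have uL : csum u = (csum e)^-1 * L.
  apply: norm_cvg_lim; rewrite usum.
  by apply: cvgM; [exact: cvg_cst|exact: dYL].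
have DeL := pseval_weighted_cvg q1 hK dC eS.
have phiL : phi32 (delta / gamma) (- a * t) (- b * t) (- t * z) (- t * z^-1)
    q gamma = (csum d)^-1 * L.
  apply: norm_cvg_lim.
  rewrite (_ : phi32_term _ _ _ _ _ _ _ = fun k => (csum d)^-1 * (D k * e k)).
    exact: csumZ.
  apply/funext => k; have mk := qpoch_neq0 k q0 mO; have nk := qpoch_neq0 k q0 nO.
  have -> : D k = csum d * qpoch (- a * t) q k * qpoch (- b * t) q k
      / (qpoch (- t * z) q k * qpoch (- t * z^-1) q k).
    rewrite (qdiff_csum_qpoch q1 hK dC dP dcv) mulrAC divff ?mul1r//.
    exact: mulf_neq0.
  rewrite /phi32_term /e /qbinomial_coef.
  move: (qpoch (- t * z) q k) (qpoch (- t * z^-1) q k) mk nk => pm pn pm0 pn0.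
  by field; rewrite pm0 pn0 D00 qn0.
rewrite uL phiL -Ypochoo -(mulrA (qpochoo gamma q)) -D0E.
by field; rewrite D00 boo0 aoo0 Y00 goo0.
Qed.

End Transformation.

(** * Absolute completeness of the complex numbers *)

Section ComplexComplete.
Local Open Scope classical_set_scope.
Local Open Scope complex_scope.
Context {R : realType}.

Lemma norm_Im_le (x : R[i]) : `|complex.Im x|%:C <= `|x|.
Proof.
by rewrite normc_def lecR -sqrtr_sqr ler_wsqrtr// lerDr sqr_ge0.
Qed.

(** Meant for the real and the imaginary part. *)
Lemma abs_summable_part (f : R[i] -> R) (u : nat -> R[i]) :
  (forall x, `|f x|%:C <= `|x|) -> abs_summable u -> cvgn (series (f \o u)).
Proof.
move=> fle [M uM]; apply: normed_cvg; apply: nondecreasing_is_cvgn.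
  by apply: nondecreasing_series => n _ _; exact: normr_ge0.
exists (complex.Re M) => _ [n _ <-]; rewrite /series/=.
suff : (\sum_(0 <= k < n) `|f (u k)|)%:C <= M by rewrite lecE => /andP[].
apply: le_trans (uM n); rewrite rmorph_sum/=.
by apply: ler_sum => i _; exact: fle.
Qed.

Lemma complex_norm_le (x : R[i]) :
  `|x| <= (`|complex.Re x| + `|complex.Im x|)%:C.
Proof.
rewrite {1}[x]complexE (le_trans (ler_normD _ _))// rmorphD/=.
have nC (r : R) : `|r%:C| = `|r|%:C.
  by rewrite normc_def/= expr0n/= addr0 sqrtr_sqr.
rewrite normrM !nC (_ : `|'i%C| = 1) ?mul1r//.
by rewrite normc_def/= expr0n/= add0r expr1n sqrtr1.
Qed.

Lemma complex_abs_complete : abs_complete R[i].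
Proof.
move=> u uS.
have := abs_summable_part (@normc_ge_Re R) uS.
have := abs_summable_part norm_Im_le uS.
move=> /cvg_ex[y /cvgrPdist_lt uy] /cvg_ex[x /cvgrPdist_lt ux].
apply/cvg_ex; exists (x +i* y); apply/cvgrPdist_lt => eps.
rewrite ltcE /= => /andP[/eqP eps_im eps0].
have e2 : 0 < complex.Re eps / 2 by rewrite divr_gt0.
near=> n; rewrite (le_lt_trans (complex_norm_le _))// ltcE/= eps_im eqxx/=.
have -> : complex.Re (x +i* y - series u n) = x - series (@complex.Re R \o u) n.
  by rewrite raddfB/= /series/= raddf_sum.
have -> : complex.Im (x +i* y - series u n) = y - series (@complex.Im R \o u) n.
  by rewrite raddfB/= /series/= raddf_sum.
rewrite [ltRHS]splitr ltrD//.
  by near: n; exact: ux.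
by near: n; exact: uy.
Unshelve. all: by end_near. Qed.

End ComplexComplete.

Theorem theorem2p8 (R : realType) (q x z a b t delta gamma : R[i]) :
  let u : nat -> R[i] := fun n : nat =>
    q ^+ 'C(n, 2) * t ^+ n * qpoch gamma q n
    / (qpoch q q n * qpoch delta q n) * ASC n x a b q^-1 in
  0 < `|q| < 1 -> z != 0 -> x = (z + z^-1) / 2 ->
  `|t| < 1 -> 0 < `|gamma| < 1 ->
  ~ Omega q delta -> ~ Omega q (- t * z) -> ~ Omega q (- t * z^-1) ->
  ~ Omega q (- a * t) -> ~ Omega q (- b * t) ->
  (`|a * t| < 1 -> `|b * t| < 1 -> csummable u) /\
  (csummable u ->
   csum u =
     (qpochoo gamma q * qpochoo (- t * z) q * qpochoo (- t * z^-1) q)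
     / (qpochoo delta q * qpochoo (- a * t) q * qpochoo (- b * t) q)
     * phi32 (delta / gamma) (- a * t) (- b * t) (- t * z) (- t * z^-1)
         q gamma).
Proof.
move=> u /andP[q0 q1] z0 xE _ *.
have -> : u = fun n => q ^+ 'C(n, 2) * t ^+ n * qpoch gamma q n
    / (qpoch q q n * qpoch delta q n) * ASC_z n z a b q^-1.
  by apply/funext => n; rewrite /u (ASCE _ _ _ _ z0 xE).
apply: (ASC_transform (@complex_abs_complete R)) => //.
by rewrite -normr_gt0.
Qed.
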